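(* Let $I=(G=(V,E),\mathcal{C},\omega,\ell,b)$ be an instance of \textsc{Stars NWS} and $E^*\subseteq E$. Let $C\in\mathcal{C}$ be a community containing no local edge (no edge of $E^*$ has both endpoints in $C$), and let $D\in\mathcal{C}$ with $|C\cap D|\ge 2$. Then for every solution $G'$ with $\mathrm{univ}_{G'}(C)\not\subseteq C\cap D$, the communities $C$ and $D$ induce a local cycle in $G'$ that uses at least one edge not in $E^*$.
   Context: A solution of \textsc{Stars NWS} is a spanning subgraph $G'=(V,E')$, $E'\subseteq E$, $|E'|\le\ell$, $\omega(E')\le b$, such that for each $C\in\mathcal{C}$ the set $\mathrm{univ}_{G'}(C)$ of vertices $u\in C$ adjacent in $G'$ to all of $C\setminus\{u\}$ is nonempty. Edges of $E^*$ are called local edges. Two communities $C_1,C_2$ induce a local cycle in $G'$ if there are $c_i\in\mathrm{univ}_{G'}(C_i)$ ($i=1,2$) such that the graph on $C_1\cup C_2$ with edges $\{\{c_i,w\}: w\in C_i\setminus\{c_i\}, i\in\{1,2\}\}$ contains a cycle; such cycles are local cycles. *)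

(* Defs.v *)
From mathcomp Require Import all_boot all_order all_algebra.
Set Implicit Arguments.
Unset Strict Implicit.
Unset Printing Implicit Defensive.

Import Order.TTheory GRing.Theory Num.Theory.

(* The vertex set is the finite type V; a finite simple graph on V is given by
   its edge set, a set of two-element sets of vertices. *)

(* Weights are total on {set V}; only values on edges are ever used. *)
Record stars_nws (V : finType) (R : realDomainType) := StarsNWS {
  edges : {set {set V}};
  edges_card2 : forall e, e \in edges -> #|e| = 2;
  communities : {set {set V}};
  weight : {set V} -> R;
  max_edges : nat;
  budget : R
}.

Definition univ (V : finType) (E' : {set {set V}}) (C : {set V}) : {set V} :=
  [set u in C | [forall w in C :\ u, [set u; w] \in E']].

(* The spanning subgraph (V, E') is identified with its edge set E'. *)
Definition solution (V : finType) (R : realDomainType) (I : stars_nws V R)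
    (E' : {set {set V}}) : Prop :=
  [/\ E' \subset edges I,
      #|E'| <= max_edges I,
      (\sum_(e in E') weight I e <= budget I)%R
    & forall C, C \in communities I -> univ E' C != set0].

Definition star_edges (V : finType) (c : V) (C : {set V}) : {set {set V}} :=
  [set [set c; w] | w in C :\ c].

(* p lists the pairwise distinct vertices of a cycle of the graph (U, F), in
   cyclic order. *)
Definition is_cycle (V : finType) (U : {set V}) (F : {set {set V}})
    (p : seq V) : Prop :=
  [/\ 2 < size p, {subset p <= U} & ucycle (fun x y => [set x; y] \in F) p].

Definition cycle_edges (V : finType) (p : seq V) : {set {set V}} :=
  [set [set x; next p x] | x in p].

Definition local_cycle (V : finType) (E' : {set {set V}}) (C1 C2 : {set V})
    (p : seq V) : Prop :=
  exists c1 c2 : V,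
    [/\ c1 \in univ E' C1, c2 \in univ E' C2
      & is_cycle (C1 :|: C2) (star_edges c1 C1 :|: star_edges c2 C2) p].

(* Main.v *)
(** Let [c] be a centre of [C] outside [D], [d] a centre of [D], and [x], [y]
    two common vertices.  The star at [d] joins [x] to [y] by a path inside [D];
    this path avoids [c], which is adjacent to both of its ends in its own star
    and so closes it to a cycle.  The edge [{c, x}] of that cycle is contained
    in [C], hence is not local. *)
Require Import Defs.
From mathcomp Require Import all_boot all_order all_algebra.
Set Implicit Arguments.
Unset Strict Implicit.
Unset Printing Implicit Defensive.

Definition adjacent (V : finType) (F : {set {set V}}) : rel V :=
  fun x y => [set x; y] \in F.

Section EdgeSets.
Variable V : finType.
Implicit Types (c d u v w x y : V) (C D U W : {set V}) (E F : {set {set V}}).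
Implicit Types (p : seq V).

Lemma adjacent_sym F : symmetric (adjacent F).
Proof. by move=> u v; rewrite /adjacent setUC. Qed.

Lemma sub_adjacent E F : E \subset F -> subrel (adjacent E) (adjacent F).
Proof. by move=> /subsetP EF u v; apply: EF. Qed.

Lemma path_adjacent_sub D F x p :
  F \subset powerset D -> x \in D -> path (adjacent F) x p ->
  {subset x :: p <= D}.
Proof.
move=> /subsetP FD xD xp; apply/allP; rewrite /= xD /=.
elim: p x xD xp => //= v p IHp x _ /andP[/FD xv vp].
have vD : v \in D.
  by move: xv; rewrite powersetE subUset !sub1set => /andP[].
by rewrite vD (IHp v).
Qed.

Lemma cycle_edges_head x y p : [set x; y] \in cycle_edges [:: x, y & p].
Proof. by apply/imsetP; exists x; rewrite ?mem_head //= eqxx. Qed.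

Lemma univ_sub E C : univ E C \subset C.
Proof. by rewrite /univ setIdE subsetIl. Qed.

Lemma star_edges_sub c C : c \in C -> star_edges c C \subset powerset C.
Proof.
move=> cC; apply/subsetP=> _ /imsetP[w /setD1P[_ wC] ->].
by rewrite powersetE subUset !sub1set cC.
Qed.

Lemma star_adjacent c C w :
  w \in C -> w != c -> adjacent (star_edges c C) c w.
Proof. by move=> wC wc; apply: imset_f; rewrite !inE wc. Qed.

Lemma star_connect c C :
  {in C &, forall u v, connect (adjacent (star_edges c C)) u v}.
Proof.
have centre_connect w : w \in C -> connect (adjacent (star_edges c C)) c w.
  move=> wC; have [->|wc] := eqVneq w c; first exact: connect0.
  exact/connect1/star_adjacent.
move=> u v uC vC; apply: connect_trans (centre_connect v vC).
by rewrite (sym_connect_sym (@adjacent_sym _)) centre_connect.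
Qed.

Lemma is_cycle_widen U W F p : U \subset W -> is_cycle U F p -> is_cycle W F p.
Proof. by move=> /subsetP UW [p_gt2 pU pF]; split=> // v /pU/UW. Qed.

Lemma connect_closes_cycle D E F c x y :
  E \subset powerset D -> E \subset F -> c \notin D -> x \in D -> x != y ->
  adjacent F c x -> adjacent F c y -> connect (adjacent E) x y ->
  exists p, is_cycle (c |: D) F [:: c, x & p].
Proof.
move=> ED EF cD xD xy cx cy /connectP[q xq y_last].
move: xy cy; rewrite {}y_last.
case/shortenP: xq => p xp p_uniq _ xy cy; exists p.
have pD := path_adjacent_sub ED xD xp.
split.
- by case: p xy {xp p_uniq pD cy}; rewrite //= eqxx.
- move=> v; rewrite in_cons in_setU1 => /predU1P[->|/pD->].
    by rewrite eqxx.
  by rewrite orbT.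
- rewrite /ucycle cons_uniq p_uniq (contra (@pD c) cD) /= !andbT rcons_path.
  apply/and3P; split=> //; first exact: sub_path (sub_adjacent EF) _ _ xp.
  by have := cy; rewrite adjacent_sym.
Qed.

Lemma star_union_cycle C D c d x y :
  c \in C :\: D -> d \in D -> x \in C :&: D -> y \in C :&: D -> x != y ->
  exists p, is_cycle (C :|: D) (star_edges c C :|: star_edges d D)
    [:: c, x & p].
Proof.
move=> /setDP[cC cD] dD xCD yCD xy.
have [[xC xD] [yC yD]] := (setIP xCD, setIP yCD).
have adjacent_c w : w \in C -> w \in D ->
    adjacent (star_edges c C :|: star_edges d D) c w.
  move=> wC wD; apply: sub_adjacent (subsetUl _ _) _ _ _.
  by apply: star_adjacent => //; apply: contraNneq cD => <-.
have [p p_cycle] := connect_closes_cycle (star_edges_sub dD)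
  (subsetUr (star_edges c C) _) cD xD xy (adjacent_c x xC xD)
  (adjacent_c y yC yD) (star_connect d xD yD).
by exists p; apply: is_cycle_widen p_cycle; rewrite setSU ?sub1set.
Qed.

End EdgeSets.

Theorem lemma14 (V : finType) (R : realDomainType) (I : stars_nws V R)
    (Estar : {set {set V}}) (C D : {set V})
    (hEstar : Estar \subset edges I)
    (hC : C \in communities I)
    (hlocal : forall e : {set V}, e \in Estar -> ~~ (e \subset C))
    (hD : D \in communities I)
    (hCD : 2 <= #|C :&: D|) :
  forall E' : {set {set V}}, solution I E' ->
    ~~ (univ E' C \subset C :&: D) ->
    exists p : seq V,
      local_cycle E' C D p /\
      exists e : {set V}, e \in cycle_edges p /\ e \notin Estar.
Proof.
move=> E' [_ _ _ /(_ D hD)/set0Pn[d d_univ]] /subsetPn[c c_univ].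
have cC := subsetP (univ_sub _ _) _ c_univ.
have dD := subsetP (univ_sub _ _) _ d_univ.
rewrite inE cC /= => cD.
have cCD : c \in C :\: D by rewrite inE cC cD.
have [x [y [xCD yCD xy]]] := card_gt1P hCD.
have [p p_cycle] := star_union_cycle cCD dD xCD yCD xy.
exists [:: c, x & p]; split; first by exists c, d.
exists [set c; x]; split; first exact: cycle_edges_head.
apply: contraL (hlocal [set c; x]) _.
by rewrite subUset !sub1set cC; case/setIP: xCD.
Qed.
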